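(* Let $m,n\ge 1$ be integers and let $A\in\mathbb{R}^{(n+m)\times(mn)}$ be the block matrix $$A=\begin{bmatrix} -I_n&-I_n&-I_n&\cdots&-I_n\\ e_n&0_n&0_n&\cdots&0_n\\ 0_n&e_n&0_n&\cdots&0_n\\ 0_n&0_n&e_n&\cdots&0_n\\ \vdots&\vdots&\vdots&\ddots&\vdots\\ 0_n&0_n&0_n&\cdots&e_n \end{bmatrix},$$ which has $m$ block columns of width $n$, a first block row of height $n$ in which all $m$ blocks equal $-I_n$, and then $m$ further rows, the $i$-th of which has $e_n$ in block column $i$ and $0_n$ in all other block columns. Then $A$ is totally unimodular.
   Context: $I_n$ is the $n\times n$ identity matrix, $e_n=(1,1,\dots,1)$ and $0_n=(0,0,\dots,0)$ are row vectors of length $n$. A matrix is totally unimodular if each of its square submatrices has determinant $0$, $1$ or $-1$. The matrix $A$ is the system matrix of the transportation problem for expendable resources, with $m$ relief centres and $n$ incident points and variables $x_{ij}$ ordered as $(x_{11},\dots,x_{1n},x_{21},\dots,x_{mn})$: the first $n$ rows encode $-\sum_{i=1}^m x_{ij}\le -d_j$ (demands) and the last $m$ rows encode $\sum_{j=1}^n x_{ij}\le s_i$ (supplies). *)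

(* Defs.v *)
From mathcomp Require Import all_boot all_order all_algebra.
From mathcomp Require Import reals.

Set Implicit Arguments.
Unset Strict Implicit.
Unset Printing Implicit Defensive.

Import GRing.Theory.
Local Open Scope ring_scope.

(* Strictly increasing f and g make [mxsub f g A] a submatrix in the usual
   sense: a choice of k distinct rows and k distinct columns, in order. *)
Definition totally_unimodular (R : comNzRingType) (p q : nat)
    (A : 'M[R]_(p, q)) : Prop :=
  forall (k : nat) (f : 'I_k -> 'I_p) (g : 'I_k -> 'I_q),
    {homo f : i j / (i < j)%N} -> {homo g : i j / (i < j)%N} ->
    [\/ \det (mxsub f g A) = 0, \det (mxsub f g A) = 1
      | \det (mxsub f g A) = -1].

Lemma block_width (m n : nat) : (\sum_(i < m) n = m * n)%N.
Proof. by rewrite sum_nat_const card_ord. Qed.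

(* [\mxrow] lays out its blocks in increasing order of index, so that column
   i * n + j carries the variable x_ij (indices from 0).  It gives a matrix
   whose width is literally a sum, hence the cast to width m * n. *)
Definition transport_mx (R : comNzRingType) (m n : nat) :
    'M[R]_(n + m, m * n) :=
  castmx (erefl, block_width m n)
    (col_mx
      (\mxrow_(i < m) - (1%:M : 'M[R]_n))
      (\matrix_(l < m)
         \mxrow_(i < m) (if i == l then const_mx 1 else 0 : 'rV[R]_n))).

(* Main.v *)
(** Every column of the matrix has at most one entry 1, at most one entry -1,
    and zeros elsewhere, as in the incidence matrix of a directed graph; this
    property passes to submatrices.  For a square matrix of this kind, either
    every column has both a 1 and a -1, so that the rows sum to zero and the
    determinant vanishes, or some column has at most one nonzero entry, and
    expanding along it reduces the claim to a smaller matrix. *)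

Require Import Defs.
From mathcomp Require Import all_boot all_order all_algebra.
From mathcomp Require Import reals.

Set Implicit Arguments.
Unset Strict Implicit.
Unset Printing Implicit Defensive.

Import GRing.Theory.
Local Open Scope ring_scope.

(* The value [None] of [h] or [t] is an arc whose head or tail has been
   deleted. *)
Definition incidence_mx (R : comNzRingType) (p q : nat) (A : 'M[R]_(p, q)) :=
  forall j, exists h t : option 'I_p,
    forall i, A i j = (h == Some i)%:R - (t == Some i)%:R.

Lemma incidence_mxsub (R : comNzRingType) (p q p' q' : nat)
    (f : 'I_p' -> 'I_p) (g : 'I_q' -> 'I_q) (A : 'M[R]_(p, q)) :
  injective f -> incidence_mx A -> incidence_mx (mxsub f g A).
Proof.
move=> f_inj incA j; have [h [t Aj]] := incA (g j).
(* An endpoint is pulled back along [f], and becomes [None] when its row is not selected;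
   injectivity makes the preimage unique. *)
pose pull (o : option 'I_p) := [pick i | o == Some (f i)].
have pullE o i : (pull o == Some i) = (o == Some (f i)).
  rewrite /pull; case: pickP => [i0 /eqP-> | ->] //.
  exact: esym (inj_eq f_inj i0 i).
by exists (pull h), (pull t) => i; rewrite mxE Aj !pullE.
Qed.

(** The all-ones row is killed by [A]; multiplying on the right by the adjugate makes [\det A] times
    that row vanish, with no division in [R]. *)
Lemma det_colsum0 (R : comNzRingType) (k : nat) (A : 'M[R]_k.+1) :
  (forall j, \sum_i A i j = 0) -> \det A = 0.
Proof.
move=> sum0.
have A0 : const_mx 1 *m A = 0 :> 'rV_k.+1.
  apply/rowP => j; rewrite !mxE -[RHS](sum0 j).
  by apply: eq_bigr => i _; rewrite mxE mul1r.
have := congr1 (mulmx^~ (\adj A)) A0.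
rewrite -mulmxA mul_mx_adj mul0mx mul_mx_scalar => /rowP/(_ ord0).
by rewrite !mxE mulr1.
Qed.

Lemma det_col_single (R : comNzRingType) (k : nat) (A : 'M[R]_k.+1)
    (i0 j : 'I_k.+1) (c : R) :
  (forall i, A i j = c * (i0 == i)%:R) ->
  \det A = c * (-1) ^+ (i0 + j) * \det (row' i0 (col' j A)).
Proof.
move=> Aj; rewrite (expand_det_col A j) (bigD1 i0) //= big1 => [|i].
  by rewrite addr0 Aj eqxx mulr1 mulrA.
by rewrite eq_sym Aj => /negPf->; rewrite mulr0 mul0r.
Qed.

Lemma det_incidence (R : comNzRingType) (k : nat) (A : 'M[R]_k) :
  incidence_mx A -> [\/ \det A = 0, \det A = 1 | \det A = -1].
Proof.
elim: k A => [|k IHk] A incA; first by rewrite det_mx00; constructor 2.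
have signM (n : nat) (x : R) : [\/ x = 0, x = 1 | x = -1] ->
    [\/ (-1) ^+ n * x = 0, (-1) ^+ n * x = 1 | (-1) ^+ n * x = -1].
  rewrite -signr_odd; case: (odd n); rewrite ?mul1r // mulN1r.
  by case=> ->; rewrite ?oppr0 ?opprK; [constructor 1|constructor 3|constructor 2].
have IH i j : [\/ \det (row' i (col' j A)) = 0, \det (row' i (col' j A)) = 1
                | \det (row' i (col' j A)) = -1].
  apply: IHk; rewrite (_ : row' _ _ = mxsub (lift i) (lift j) A).
    exact: incidence_mxsub lift_inj incA.
  by apply/matrixP => i' j'; rewrite !mxE.
(* A column with nonzero sum has exactly one endpoint: two endpoints cancel, and none gives a zero
   column. *)
have [/existsP[j /eqP sum_n0] | /existsPn sum0] :=
    boolP [exists j, \sum_i A i j != 0]; last first.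
  by constructor 1; apply: det_colsum0 => j; apply/eqP; rewrite -[_ == _]negbK.
have sum_delta (i0 : 'I_k.+1) : \sum_i (Some i0 == Some i)%:R = 1 :> R.
  rewrite (bigD1 i0) //= eqxx big1 ?addr0 // => i /negPf.
  by rewrite eq_sym => i0_i; rewrite (inj_eq Some_inj) i0_i.
have [[h|] [[t|] Aj]] := incA j.
- case: sum_n0; under eq_bigr do rewrite Aj.
  by rewrite sumrB !sum_delta subrr.
- rewrite (@det_col_single _ _ _ h j 1) ?mul1r; first exact: signM.
  by move=> i; rewrite Aj subr0 mul1r.
(* The coefficient -1 is absorbed into the power of -1, so that [signM] applies. *)
- rewrite (@det_col_single _ _ _ t j (-1)) -?exprS; first exact: signM.
  by move=> i; rewrite Aj sub0r mulN1r.
- by case: sum_n0; apply: big1 => i _; rewrite Aj subr0.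
Qed.

(** The column of x_ij is an arc with head at supply row i and tail at demand row j; [tagnat.sig1]
    and [tagnat.sig2] read i and j off the column index. *)
Lemma incidence_transport_mx (R : comNzRingType) (m n : nat) :
  incidence_mx (transport_mx R m n).
Proof.
move=> j; pose c := cast_ord (esym (block_width m n)) j.
exists (Some (rshift n (tagnat.sig1 c))), (Some (lshift m (tagnat.sig2 c))) => i.
rewrite castmxE /= cast_ord_id -/c !(inj_eq Some_inj).
case: (split_ordP i) => l ->.
  rewrite col_mxEu !mxE (inj_eq (@lshift_inj _ _)) eq_rlshift sub0r.
  by rewrite eq_sym.
rewrite col_mxEd !mxE (inj_eq (@rshift_inj _ _)) eq_lrshift subr0.
by case: ifP => _; rewrite mxE.
Qed.

Theorem theorem5p1 (R : realType) (m n : nat) (hm : (1 <= m)%N)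
  (hn : (1 <= n)%N) : totally_unimodular (transport_mx R m n).
Proof.
move=> k f g f_incr _; apply: det_incidence.
apply: incidence_mxsub (@incidence_transport_mx R m n) => i j fij.
by apply: val_inj; case: (ltngtP i j) => // /f_incr; rewrite fij ltnn.
Qed.
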